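(* Let $R$ be a ring and, for $n\in\mathbb{N}$ ($n\ge 1$), let $T_n(R)$ be the ring of $n\times n$ upper triangular matrices over $R$. The following statements are equivalent: (1) $R$ is a UnitUC ring. (2) $T_n(R)$ is UnitUC for all $n\in\mathbb{N}$. (3) $T_n(R)$ is UnitUC for some $n\in\mathbb{N}$.
   Context: Rings are associative with $1\neq 0$; $U(R)$ is the group of units, $Id(R)$ the set of idempotents of $R$. A ring $R$ is clean if every $a\in R$ can be written as $a=e+u$ with $e\in Id(R)$, $u\in U(R)$. For $e,f\in Id(R)$ write $e\sim f$ if there is $u\in U(R)$ with $e=u^{-1}fu$. $R$ is unit uniquely clean (UnitUC) if it is clean and, whenever $e+u=f+v$ with $e,f\in Id(R)$ and $u,v\in U(R)$, one has $e\sim f$. *)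

(* Defs.v *)
From HB Require Import structures.
From mathcomp Require Import all_boot all_order all_algebra.

Set Implicit Arguments.
Unset Strict Implicit.
Unset Printing Implicit Defensive.

Import GRing.Theory.
Local Open Scope ring_scope.

(* A unitRingType carries a decision procedure for invertibility, which an     *)
(* arbitrary ring need not have; units are therefore described by two-sided    *)
(* inverses over nzRingType (associative, 1 != 0, not nec. commutative).       *)
Definition inverse_of (R : nzRingType) (u v : R) : Prop :=
  u * v = 1 /\ v * u = 1.

Definition is_unit (R : nzRingType) (u : R) : Prop :=
  exists v : R, inverse_of u v.

Definition is_idem (R : nzRingType) (e : R) : Prop := e * e = e.

Definition clean (R : nzRingType) : Prop :=
  forall a : R, exists e u : R, [/\ is_idem e, is_unit u & a = e + u].

(* Here v is the inverse of u: e = u^-1 * f * u. *)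
Definition unit_conj (R : nzRingType) (e f : R) : Prop :=
  exists u v : R, inverse_of u v /\ e = v * f * u.

Definition unitUC (R : nzRingType) : Prop :=
  clean R /\
  forall e f u v : R, is_idem e -> is_idem f -> is_unit u -> is_unit v ->
    e + u = f + v -> unit_conj e f.

(* is_trig_mx is the library's predicate for LOWER triangular matrices. *)
Definition upper_trig (R : nzRingType) (n : nat) : {pred 'M[R]_n} :=
  fun A => is_trig_mx A^T.

Lemma upper_trigP (R : nzRingType) (n : nat) (A : 'M[R]_n) :
  reflect (forall i j : 'I_n, (j < i)%N -> A i j = 0) (A \in @upper_trig R n).
Proof.
apply: (iffP (@is_trig_mxP _ _ _ A^T)) => A0 i j ltij.
  by rewrite -(A0 j i) ?mxE.
by rewrite mxE A0.
Qed.

Lemma upper_trig_subring_closed (R : nzRingType) (n : nat) :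
  subring_closed (@upper_trig R n).
Proof.
split.
- by apply/upper_trigP => i j ltji; rewrite mxE -val_eqE /= gtn_eqF.
- move=> A B /upper_trigP A0 /upper_trigP B0; apply/upper_trigP => i j ltji.
  by rewrite !mxE A0 // B0 // subr0.
move=> A B /upper_trigP A0 /upper_trigP B0; apply/upper_trigP => i j ltji.
rewrite mxE big1 // => k _; have [ltki|leik] := ltnP k i.
  by rewrite A0 ?mul0r.
by rewrite B0 ?mulr0 ?(leq_trans ltji).
Qed.

Record upper_trig_mx (R : nzRingType) (n : nat) : Type :=
  UpperTrigMx {ut_val :> 'M[R]_n; _ : ut_val \in @upper_trig R n}.

HB.instance Definition _ (R : nzRingType) (n : nat) :=
  [isSub of upper_trig_mx R n for @ut_val R n].
HB.instance Definition _ (R : nzRingType) (n : nat) :=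
  [Choice of upper_trig_mx R n by <:].
HB.instance Definition _ (R : nzRingType) (n : nat) :=
  GRing.SubChoice_isSubPzRing.Build 'M[R]_n (@upper_trig R n)
    (upper_trig_mx R n) (@upper_trig_subring_closed R n).

Lemma ut_oner_neq0 (R : nzRingType) (n : nat) :
  (1 : upper_trig_mx R n.+1) != 0.
Proof. by rewrite -(inj_eq val_inj); exact: (oner_neq0 'M[R]_n.+1). Qed.

(* As for 'M[R]_n, the ring is nontrivial only for positive dimension. *)
HB.instance Definition _ (R : nzRingType) (n : nat) :=
  GRing.PzSemiRing_isNonZero.Build (upper_trig_mx R n.+1) (@ut_oner_neq0 R n).

(* Main.v *)
Require Import Defs.
From mathcomp Require Import all_boot all_order all_algebra.

Import GRing.Theory.
Local Open Scope ring_scope.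

(** Evaluating a diagonal entry is a ring morphism from T_n(R) to R, and a
    triangular matrix is a unit as soon as its diagonal entries are, because
    strictly triangular matrices are nilpotent.  Hence cleanness is decided on
    the diagonal.  An idempotent E of T_n(R) is conjugate to its diagonal part D
    through W = ED + (1 - E)(1 - D), which satisfies EW = WD and has unit
    diagonal; so conjugacy of idempotents is decided on the diagonal as well. *)

Lemma is_unit_of_left_right {R : nzRingType} (a b c : R) :
  a * b = 1 -> c * a = 1 -> is_unit a.
Proof.
move=> ab1 ca1; exists b; split=> //.
(* The one-sided inverses agree, since both equal [c * a * b]. *)
by rewrite -[b]mul1r -{1}ca1 -(mulrA c) ab1 mulr1.
Qed.

Lemma unit_conj_sym {R : nzRingType} (e f : R) : unit_conj e f -> unit_conj f e.
Proof.
move=> [u [v [[uv1 vu1] ->]]]; exists v, u; split=> //.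
by rewrite -!mulrA uv1 mulr1 mulrA uv1 mul1r.
Qed.

Lemma unit_conj_trans {R : nzRingType} (e f g : R) :
  unit_conj e f -> unit_conj f g -> unit_conj e g.
Proof.
move=> [u [v [[uv1 vu1] ->]]] [s [t [[st1 ts1] ->]]].
exists (s * u), (v * t); split; last by rewrite !mulrA.
split; rewrite mulrA.
  by rewrite -(mulrA s) uv1 mulr1.
by rewrite -(mulrA v) ts1 mulr1.
Qed.

Lemma unit_conj_intertwined {R : nzRingType} (e f w : R) :
  is_unit w -> e * w = w * f -> unit_conj e f.
Proof.
move=> [v [wv1 vw1]] ew; exists v, w; split=> //.
by rewrite -ew -mulrA wv1 mulr1.
Qed.

Lemma idem_compl {R : nzRingType} {e : R} :
  is_idem e -> (1 - e) * (1 - e) = 1 - e.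
Proof. by move=> ee; rewrite mulrBl mul1r mulrBr mulr1 ee subrr subr0. Qed.

(** Both sides collapse to [e * d], because [e * (1 - e)] and [(1 - d) * d] vanish. *)
Lemma idem_intertwiner {R : nzRingType} (e d : R) : is_idem e -> is_idem d ->
  e * (e * d + (1 - e) * (1 - d)) = (e * d + (1 - e) * (1 - d)) * d.
Proof.
move=> ee dd; have e1e : e * (1 - e) = 0 by rewrite mulrBr mulr1 ee subrr.
have d1d : (1 - d) * d = 0 by rewrite mulrBl mul1r dd subrr.
rewrite mulrDr [RHS]mulrDl -[in RHS]mulrA dd -[in RHS]mulrA d1d mulr0.
by rewrite !mulrA ee e1e mul0r.
Qed.

Section UpperTriangular.
Variables (R : nzRingType) (n : nat).
Local Notation T := (upper_trig_mx R n.+1).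
Implicit Types (A B E : T) (d : 'I_n.+1 -> R) (i j : 'I_n.+1).

Lemma ut_lt0 A i j : (j < i)%N -> ut_val A i j = 0.
Proof. by apply/upper_trigP; exact: (valP A). Qed.

Lemma ut_addE A B i j : ut_val (A + B) i j = ut_val A i j + ut_val B i j.
Proof. exact: mxE. Qed.

Lemma ut_subE A B i j : ut_val (A - B) i j = ut_val A i j - ut_val B i j.
Proof. by rewrite [LHS]mxE [X in _ + X]mxE. Qed.

Lemma ut_oneE i j : ut_val (1 : T) i j = (i == j)%:R.
Proof. exact: mxE. Qed.

Lemma ut_mulE A B i j :
  ut_val (A * B) i j = \sum_k ut_val A i k * ut_val B k j.
Proof. exact: mxE. Qed.

Lemma ut_mul_diag A B i : ut_val (A * B) i i = ut_val A i i * ut_val B i i.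
Proof.
rewrite ut_mulE (bigD1 i) //= big1 ?addr0 // => k neq_ki.
(* Off the diagonal, one factor lies below it: that of [A] if [k < i], that of [B] if [i < k]. *)
have [ltki|ltik|/val_inj eq_ki] := ltngtP k i.
- by rewrite ut_lt0 ?mul0r.
- by rewrite (ut_lt0 B) ?mulr0.
by rewrite eq_ki eqxx in neq_ki.
Qed.

Lemma ut_diag_inverse A B i :
  inverse_of A B -> inverse_of (ut_val A i i) (ut_val B i i).
Proof.
by move=> [AB1 BA1]; split; rewrite -ut_mul_diag ?AB1 ?BA1 ut_oneE eqxx.
Qed.

Lemma ut_diag_unit A i : is_unit A -> is_unit (ut_val A i i).
Proof. by move=> [B /(ut_diag_inverse _ _ i) AB]; exists (ut_val B i i). Qed.

Lemma ut_diag_idem E i : is_idem E -> is_idem (ut_val E i i).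
Proof. by move=> EE; rewrite /is_idem -ut_mul_diag EE. Qed.

Lemma ut_diag_conj A B i :
  unit_conj A B -> unit_conj (ut_val A i i) (ut_val B i i).
Proof.
move=> [U [V [UV ->]]]; exists (ut_val U i i), (ut_val V i i).
by split; [exact: ut_diag_inverse | rewrite !ut_mul_diag].
Qed.

Lemma diag_upper_trig d : diag_mx (\row_i d i) \in @upper_trig R n.+1.
Proof. by apply/upper_trigP => i j ltji; rewrite !mxE -val_eqE gtn_eqF. Qed.

Definition ut_diag d : T := UpperTrigMx (diag_upper_trig d).

Lemma ut_diagE d i j : ut_val (ut_diag d) i j = d i *+ (i == j).
Proof. by rewrite /= !mxE. Qed.

Lemma ut_diagii d i : ut_val (ut_diag d) i i = d i.
Proof. by rewrite ut_diagE eqxx. Qed.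

Lemma eq_ut_diag d1 d2 : d1 =1 d2 -> ut_diag d1 = ut_diag d2.
Proof.
by move=> eq_d; apply/val_inj/matrixP => i j; rewrite !ut_diagE eq_d.
Qed.

Lemma ut_diagM d1 d2 : ut_diag d1 * ut_diag d2 = ut_diag (fun i => d1 i * d2 i).
Proof.
apply/val_inj/matrixP => i j; rewrite ut_mulE (bigD1 i) //= big1 => [|k neq_ki].
  by rewrite addr0 !mxE eqxx mulrnAr.
by rewrite !mxE eq_sym (negPf neq_ki) mul0r.
Qed.

Lemma ut_diagD d1 d2 : ut_diag d1 + ut_diag d2 = ut_diag (fun i => d1 i + d2 i).
Proof.
by apply/val_inj/matrixP => i j; rewrite ut_addE !ut_diagE mulrnDl.
Qed.

Lemma ut_diag1 : ut_diag (fun=> 1) = 1.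
Proof. by apply/val_inj/matrixP => i j; rewrite ut_oneE ut_diagE. Qed.

Lemma ut_diag_inverse_of d1 d2 :
  (forall i, inverse_of (d1 i) (d2 i)) -> inverse_of (ut_diag d1) (ut_diag d2).
Proof.
by move=> d12; split; rewrite ut_diagM -ut_diag1; apply: eq_ut_diag => i;
  case: (d12 i).
Qed.

Lemma ut_nilpotent A : (forall i, ut_val A i i = 0) -> A ^+ n.+1 = 0.
Proof.
(* Each further factor [A] clears one more superdiagonal; at [k = n.+1] none is left. *)
move=> A0; have AX0 k i j : (j < i + k)%N -> ut_val (A ^+ k) i j = 0.
  elim: k i j => [|k IHk] i j ltj; first by rewrite ut_lt0 // -(addn0 i).
  rewrite exprS ut_mulE big1 // => l _.
  have [ltli|ltil|/val_inj <-] := ltngtP l i.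
  - by rewrite ut_lt0 ?mul0r.
  - by rewrite IHk ?mulr0 // (leq_trans ltj) // addnS -addSn leq_add2r.
  by rewrite A0 mul0r.
apply/val_inj/matrixP => i j; rewrite AX0 ?[RHS]mxE //.
by rewrite ltn_addl.
Qed.

(** The inverse is the geometric series in the nilpotent [N = 1 - A]. *)
Lemma ut_unipotent_unit A : (forall i, ut_val A i i = 1) -> is_unit A.
Proof.
move=> A1; pose N := 1 - A.
have N0 : N ^+ n.+1 = 0.
  by apply: ut_nilpotent => i; rewrite ut_subE ut_oneE eqxx A1 subrr.
have geomN : A * (\sum_(i < n.+1) N ^+ i) = 1.
  have := subrX1 N n.+1; rewrite N0 sub0r {1}/N addrAC subrr sub0r mulNr.
  by move/oppr_inj.
exists (\sum_(i < n.+1) N ^+ i); split=> //.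
(* [A] commutes with the powers of [N], so the right inverse is also a left inverse. *)
have cAN : GRing.comm A N by rewrite /GRing.comm /N mulrBl mulrBr mul1r mulr1.
rewrite -[RHS]geomN; apply/esym/commr_sum => i _; exact: commrX.
Qed.

(** With [B] the diagonal matrix of inverses of the diagonal entries, [A * B] and [B * A] are both
    unipotent, which gives [A] an inverse on each side. *)
Lemma ut_unit A : (forall i, is_unit (ut_val A i i)) -> is_unit A.
Proof.
(* Choosing the inverses all at once is choice over a finite index set. *)
move=> /fin_all_exists [b Ab]; pose B := ut_diag b.
have [C [ABC _]] : is_unit (A * B).
  by apply: ut_unipotent_unit => i; rewrite ut_mul_diag ut_diagii; case: (Ab i).
have [D [_ DBA]] : is_unit (B * A).
  by apply: ut_unipotent_unit => i; rewrite ut_mul_diag ut_diagii; case: (Ab i).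
by apply: (@is_unit_of_left_right _ A (B * C) (D * B)); rewrite -?mulrA // mulrA.
Qed.

Lemma ut_idem_conj_diag E :
  is_idem E -> unit_conj E (ut_diag (fun i => ut_val E i i)).
Proof.
move=> EE; set D := ut_diag _.
have DD : is_idem D.
  by rewrite /is_idem ut_diagM; apply: eq_ut_diag => i; apply: ut_diag_idem.
apply: unit_conj_intertwined (idem_intertwiner _ _ EE DD).
apply: ut_unipotent_unit => i.
(* At a diagonal entry [e] of [E], the intertwiner has [e * e + (1 - e) * (1 - e) = e + (1 - e) =
   1]. *)
rewrite ut_addE !ut_mul_diag !ut_subE ut_oneE eqxx ut_diagii.
by rewrite (idem_compl (ut_diag_idem _ i EE)) (ut_diag_idem _ i EE) addrC subrK.
Qed.

Lemma ut_idem_conj E F : is_idem E -> is_idem F ->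
  (forall i, unit_conj (ut_val E i i) (ut_val F i i)) -> unit_conj E F.
Proof.
move=> EE FF /fin_all_exists [u /fin_all_exists [v EuvF]].
(* Pass from [E] to its diagonal part, then to that of [F], then to [F]; the middle conjugator is
   the diagonal matrix of the entrywise ones. *)
apply: unit_conj_trans (ut_idem_conj_diag _ EE) _.
apply: unit_conj_trans (unit_conj_sym _ _ (ut_idem_conj_diag _ FF)).
exists (ut_diag u), (ut_diag v); split.
  by apply: ut_diag_inverse_of => i; case: (EuvF i).
by rewrite !ut_diagM; apply: eq_ut_diag => i; case: (EuvF i).
Qed.

Lemma unitUC_ut : unitUC R -> unitUC T.
Proof.
move=> [cleanR conjR]; split=> [A|E F U V EE FF Uu Vu EUFV].
  have /fin_all_exists [e /fin_all_exists [u Aeu]] i := cleanR (ut_val A i i).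
  (* The idempotent can be taken diagonal: the rest of [A] then has units on its diagonal. *)
  exists (ut_diag e), (A - ut_diag e); split; last by rewrite addrC subrK.
    by rewrite /is_idem ut_diagM; apply: eq_ut_diag => i; case: (Aeu i).
  apply: ut_unit => i; rewrite ut_subE ut_diagii.
  by case: (Aeu i) => _ ui ->; rewrite addrC addKr.
apply: ut_idem_conj => // i.
apply: (conjR _ _ (ut_val U i i) (ut_val V i i)).
- exact: ut_diag_idem.
- exact: ut_diag_idem.
- exact: ut_diag_unit.
- exact: ut_diag_unit.
by rewrite -!ut_addE EUFV.
Qed.

(** Scalar matrices embed [R] in [T], and reading off the entry at [ord0] is a retraction, so
    decompositions lift to [T] and conjugacies descend. *)
Lemma ut_unitUC : unitUC T -> unitUC R.
Proof.
have unitD a : is_unit a -> is_unit (ut_diag (fun=> a)).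
  by move=> au; apply: ut_unit => i; rewrite ut_diagii.
have idemD e : is_idem e -> is_idem (ut_diag (fun=> e)).
  by move=> ee; rewrite /is_idem ut_diagM; apply: eq_ut_diag.
move=> [cleanT conjT]; split=> [a|e f u v ee ff uu vu eufv].
  have [E [U [EE Uu aEU]]] := cleanT (ut_diag (fun=> a)).
  exists (ut_val E ord0 ord0), (ut_val U ord0 ord0); split.
  - exact: ut_diag_idem.
  - exact: ut_diag_unit.
  by rewrite -ut_addE -aEU ut_diagii.
rewrite -(ut_diagii (fun=> e) ord0) -(ut_diagii (fun=> f) ord0).
apply: ut_diag_conj.
apply: (conjT _ _ _ _ (idemD _ ee) (idemD _ ff) (unitD _ uu) (unitD _ vu)).
by rewrite !ut_diagD; apply: eq_ut_diag.
Qed.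

End UpperTriangular.

Theorem proposition2p12 (R : nzRingType) :
  (unitUC R <-> (forall n : nat, unitUC (upper_trig_mx R n.+1))) /\
  (unitUC R <-> (exists n : nat, unitUC (upper_trig_mx R n.+1))).
Proof.
split; split.
- by move=> RUC n; apply: unitUC_ut.
- by move=> /(_ 0); apply: ut_unitUC.
(* The size is [n.+1], so the witness [0] stands for matrices of size one. *)
- by move=> RUC; exists 0; apply: unitUC_ut.
by move=> [n]; apply: ut_unitUC.
Qed.
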